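(* Let $L$ be a regular Lagrangian on $TQ$ and $J$ a type $(1,1)$ tensor field on $Q$ which is diagonalizable with distinct non-zero (real) eigenvalues $\lambda_1,\dots,\lambda_n$. Let $R$ be the type $(1,1)$ tensor field on $TQ$ defined by $i_{R(\xi)}\,d d_S L = i_\xi\, d d_{J^cS}L$ for all vector fields $\xi$ on $TQ$. Then a complete set of eigenvectors of $R$ can be constructed as follows: (i) let $X_i$ denote the eigenvector of $J$ with eigenvalue $\lambda_i$ and $Z_i$ the eigenvector of $\overline J$ with the same eigenvalue; (ii) for each $X_i$, construct a vector field $Y_i$ along $\tau$ such that $\overline JY_i=\lambda_iY_i-UX_i$. Then $Z_i^V$ and $X_i^H+Y_i^V$ are eigenvectors of $R$ corresponding to the eigenvalue $\lambda_i$.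
   Context: $Q$ is a smooth $n$-dimensional manifold, $\tau:TQ\to Q$ its tangent bundle with natural coordinates $(q^i,u^i)$. $L\in C^\infty(TQ)$ is regular: the Hessian $g_{ij}=\partial^2L/\partial u^i\partial u^j$ is everywhere non-singular. $S=\frac{\partial}{\partial u^i}\otimes dq^i$ is the vertical endomorphism. A type $(1,1)$ tensor field $K$ acts on 1-forms by $(K\alpha)(\xi)=\alpha(K\xi)$, and $d_KL:=K(dL)=dL\circ K$. Put $\theta_L=d_SL$, $\omega_L=d\theta_L$ (symplectic). With $\Delta=u^i\partial/\partial u^i$ and $E_L=\Delta(L)-L$, the Euler-Lagrange field $\Gamma=u^i\frac{\partial}{\partial q^i}+f^i\frac{\partial}{\partial u^i}$ is defined by $i_\Gamma d\theta_L=-dE_L$. The complete lift $J^c$ of $J$ is the type $(1,1)$ tensor field on $TQ$ with $J^c(X^c)=(JX)^c$, $J^c(X^V)=(JX)^V$ for vector fields $X$ on $Q$, where $X^c$, $X^V$ are the complete and vertical lifts. Connection: $\Gamma^i_j=-\frac12\partial f^i/\partial u^j$, $H_i=\frac{\partial}{\partial q^i}-\Gamma^k_i\frac{\partial}{\partial u^k}$, $V_i=\frac{\partial}{\partial u^i}$. For a vector field $X=X^i(q,u)\partial/\partial q^i$ along $\tau$ put $X^H=X^iH_i$, $X^V=X^iV_i$. $D^H_XF=X^H(F)$, $D^V_XF=X^V(F)$ on functions; on vector fields along $\tau$ they are determined by $[X^H,Y^V]=(D^H_XY)^V-(D^V_YX)^H$, and they extend to tensor fields along $\tau$ as derivations commuting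 with contractions. $g$ is the symmetric $(0,2)$ tensor field along $\tau$ with components $g_{ij}$; $\overline J$ is defined by $g(JX,Y)=g(X,\overline JY)$. $\theta_L$ is identified with the 1-form along $\tau$ given by $\theta_L(X)=D^V_XL$, and $(J\theta_L)(X)=\theta_L(JX)$. For a 1-form $\alpha$ along $\tau$, $d^H\alpha(X,Y)=(D^H_X\alpha)(Y)-(D^H_Y\alpha)(X)$. $U$ is the type $(1,1)$ tensor field along $\tau$ determined by $g(UX,Y)=d^H(J\theta_L)(X,Y)$. Eigenvectors of $J$ and $\overline J$ are taken as vector fields along $\tau$. ''Complete set of eigenvectors'' means that the $2n$ eigenvectors are linearly independent. *)

(* Defs.v *)
From HB Require Import structures.
From mathcomp Require Import all_boot all_order all_algebra.
From mathcomp Require Import all_classical all_reals all_analysis.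

Set Implicit Arguments.
Unset Strict Implicit.
Unset Printing Implicit Defensive.

Import Order.TTheory GRing.Theory Num.Theory.
Import numFieldNormedType.Exports.

Local Open Scope classical_set_scope.
Local Open Scope ring_scope.

(* Conventions.
   - Vectors are row vectors and a type (1,1) tensor with matrix A sends v to
     v *m A; thus A i k is the component A^k_i, and the tensor "B after A" has
     matrix A *m B.
   - A point or a tangent vector of TQ is written row_mx q u in the natural
     coordinates (q^i, u^i).
   - A geometric object is the family of its components in the charts of the
     atlas, subject to the tensorial transformation law on overlaps; values
     outside the chart domains are irrelevant. *)

Section Smoothness.
Variables (R : realType) (V W : normedModType R).

(* All iterated directional derivatives up to order k exist and are continuous
   on D; meant for V of finite dimension and D open. *)
Fixpoint Ck_on (k : nat) (D : set V) (f : V -> W) : Prop :=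
  (forall x, D x -> {for x, continuous f}) /\
  (if k is k'.+1 then
     forall v, (forall x, D x -> derivable f x v) /\
               Ck_on k' D (fun x => 'D_v f x)
   else True).

Definition smooth_on (D : set V) (f : V -> W) : Prop := forall k, Ck_on k D f.

End Smoothness.

(* Smooth structure of dimension n: an atlas of homeomorphisms onto open subsets
   of R^n with smooth transition maps, on a Hausdorff second countable space;
   param a is the inverse of the chart coord a. *)
Record smooth_structure (R : realType) (n : nat) (Q : topologicalType) := {
  chart : Type;
  dom : chart -> set Q;
  coord : chart -> Q -> 'rV[R]_n;
  param : chart -> 'rV[R]_n -> Q;
  mfd_hausdorff : hausdorff_space Q;
  mfd_second_countable : @second_countable Q;
  dom_open : forall a, open (dom a);
  dom_cover : forall p, exists a, dom a p;
  coord_dom_open : forall a, open (coord a @` dom a);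
  coordK : forall a p, dom a p -> param a (coord a p) = p;
  coord_continuous : forall a p, dom a p -> {for p, continuous (coord a)};
  param_continuous : forall a q, (coord a @` dom a) q ->
    {for q, continuous (param a)};
  transition_smooth : forall a b,
    smooth_on (coord a @` (dom a `&` dom b)) (coord b \o param a)
}.

Section Fields.
Variables (R : realType) (n : nat) (Q : topologicalType).
Variable M : smooth_structure R n Q.
Implicit Types a b : chart M.

Definition cdom a : set 'rV[R]_n := coord a @` dom a.
Definition overlap a b : set 'rV[R]_n := coord a @` (dom a `&` dom b).
Definition trans a b : 'rV[R]_n -> 'rV[R]_n := coord b \o param a.

Definition Tdom a : set 'rV[R]_(n + n) := [set x | cdom a (lsubmx x)].
Definition Toverlap a b : set 'rV[R]_(n + n) := [set x | overlap a b (lsubmx x)].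
Definition Ttrans a b (x : 'rV[R]_(n + n)) : 'rV[R]_(n + n) :=
  row_mx (trans a b (lsubmx x)) (rsubmx x *m jacobian (trans a b) (lsubmx x)).

(* Fields with coordinates in 'rV_N; jac is the matrix by which tangent
   components (here m of them) transform. *)
Section TransformationLaws.
Variables (N m : nat) (D : chart M -> set 'rV[R]_N).
Variables (ov : chart M -> chart M -> set 'rV[R]_N).
Variables (tr : chart M -> chart M -> 'rV[R]_N -> 'rV[R]_N).
Variables (jac : chart M -> chart M -> 'rV[R]_N -> 'M[R]_m).

Definition scalar_field (F : chart M -> 'rV[R]_N -> R) : Prop :=
  (forall a, smooth_on (D a) (F a : 'rV[R]_N -> R^o)) /\
  (forall a b x, ov a b x -> F b (tr a b x) = F a x).

Definition vector_field (X : chart M -> 'rV[R]_N -> 'rV[R]_m) : Prop :=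
  (forall a, smooth_on (D a) (X a)) /\
  (forall a b x, ov a b x -> X b (tr a b x) = X a x *m jac a b x).

Definition tensor11_field (A : chart M -> 'rV[R]_N -> 'M[R]_m) : Prop :=
  (forall a, smooth_on (D a) (A a)) /\
  (forall a b x, ov a b x -> A a x *m jac a b x = jac a b x *m A b (tr a b x)).

End TransformationLaws.

Definition tensor11_on_base :=
  tensor11_field cdom overlap trans (fun a b => jacobian (trans a b)).

Definition function_on_TQ := scalar_field Tdom Toverlap Ttrans.
Definition vfield_on_TQ :=
  vector_field Tdom Toverlap Ttrans (fun a b => jacobian (Ttrans a b)).
Definition tensor11_on_TQ :=
  tensor11_field Tdom Toverlap Ttrans (fun a b => jacobian (Ttrans a b)).

Definition vfield_along :=
  vector_field Tdom Toverlap Ttrans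
    (fun a b x => jacobian (trans a b) (lsubmx x)).
Definition tensor11_along :=
  tensor11_field Tdom Toverlap Ttrans
    (fun a b x => jacobian (trans a b) (lsubmx x)).

End Fields.

Section Local.
Variables (R : realType) (n : nat).
Local Notation TV := 'rV[R]_(n + n).
Implicit Types (x xi eta : TV) (v w : 'rV[R]_n).

Definition vlift v : TV := row_mx 0 v.

Definition clift (X : 'rV[R]_n -> 'rV[R]_n) x : TV :=
  row_mx (X (lsubmx x)) ('D_(rsubmx x) X (lsubmx x)).

Definition vertical_endo : 'M[R]_(n + n) := block_mx 0 1%:M 0 0.

Definition liouville x : TV := vlift (rsubmx x).

(* 1-forms on TQ are given by (point, vector) |-> value. *)
Definition dfun (F : TV -> R) x xi : R := 'D_xi (F : TV -> R^o) x.

(* Coordinate formula d_i alpha_j - d_j alpha_i, i.e. the invariant formula on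
   the vector fields with constant components xi and eta. *)
Definition dform (alpha : TV -> TV -> R) x xi eta : R :=
  'D_xi (fun y => alpha y eta : R^o) x - 'D_eta (fun y => alpha y xi : R^o) x.

Definition dK (K : TV -> 'M[R]_(n + n)) (L : TV -> R) x xi : R :=
  dfun L x (xi *m K x).

Definition dS (L : TV -> R) := dK (fun=> vertical_endo) L.

(* The composition "Jc after S". *)
Definition dJcS (Jc : TV -> 'M[R]_(n + n)) (L : TV -> R) :=
  dK (fun x => vertical_endo *m Jc x) L.

Definition energy (L : TV -> R) x : R := dfun L x (liouville x) - L x.

Definition hess (L : TV -> R) x : 'M[R]_n :=
  \matrix_(i, j) dfun (fun y => dfun L y (vlift (delta_mx 0 j))) x
                      (vlift (delta_mx 0 i)).

Definition gL (L : TV -> R) x v w : R := (v *m hess L x *m w^T) 0 0.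

Definition lie_bracket (xi eta : TV -> TV) x : TV :=
  'D_(xi x) eta x - 'D_(eta x) xi x.

Section Connection.
Variable G : TV -> TV. (* the Euler-Lagrange field; its last n components are f *)

(* conn x j i is Gamma^i_j = - 1/2 df^i/du^j. *)
Definition conn x : 'M[R]_n :=
  \matrix_(j, i)
    (- 2^-1 * dfun (fun y => rsubmx (G y) 0 i) x (vlift (delta_mx 0 j))).

Definition hlift x v : TV := row_mx v (- (v *m conn x)).

Definition hpart xi : 'rV[R]_n := lsubmx xi.
Definition vpart x xi : 'rV[R]_n := rsubmx xi + lsubmx xi *m conn x.

Lemma hpart_vpartE x xi : xi = hlift x (hpart xi) + vlift (vpart x xi).
Proof.
rewrite /hlift /vlift /hpart /vpart add_row_mx addr0.
by rewrite addrCA addNr addr0 hsubmxK.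
Qed.

Lemma hlift_vlift_inj x v w v' w' :
  hlift x v + vlift w = hlift x v' + vlift w' -> v = v' /\ w = w'.
Proof.
rewrite /hlift /vlift !add_row_mx !addr0 => /eq_row_mx[-> /addrI ->].
by [].
Qed.

Definition hlift_field (X : TV -> 'rV[R]_n) x : TV := hlift x (X x).
Definition vlift_field (X : TV -> 'rV[R]_n) x : TV := vlift (X x).

(* The two parts of [X^H, Y^V]; see DH_DV_bracket. *)
Definition DH (X Y : TV -> 'rV[R]_n) x : 'rV[R]_n :=
  vpart x (lie_bracket (hlift_field X) (vlift_field Y) x).
Definition DV (Y X : TV -> 'rV[R]_n) x : 'rV[R]_n :=
  - hpart (lie_bracket (hlift_field X) (vlift_field Y) x).

Lemma DH_DV_bracket X Y x :
  lie_bracket (hlift_field X) (vlift_field Y) x =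
  vlift (DH X Y x) - hlift x (DV Y X x).
Proof.
rewrite {1}(hpart_vpartE x (lie_bracket _ _ _)) addrC /DH /DV; congr (_ + _).
by rewrite /hlift mulNmx opp_row_mx !opprK.
Qed.

(* D^H on 1-forms along tau, forced by the derivation property and
   commutation with contractions. *)
Definition DH_form (X : TV -> 'rV[R]_n) (alpha : TV -> 'rV[R]_n -> R)
    (Y : TV -> 'rV[R]_n) x : R :=
  dfun (fun y => alpha y (Y y)) x (hlift x (X x)) - alpha x (DH X Y x).

Definition dH (alpha : TV -> 'rV[R]_n -> R) (X Y : TV -> 'rV[R]_n) x : R :=
  DH_form X alpha Y x - DH_form Y alpha X x.

End Connection.

Definition theta_along (L : TV -> R) x v : R := dfun L x (vlift v).
Definition Jtheta (J : 'rV[R]_n -> 'M[R]_n) (L : TV -> R) x v : R :=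
  theta_along L x (v *m J (lsubmx x)).

Definition is_eigenvector (m : nat) (A : 'M[R]_m) (l : R) (v : 'rV[R]_m) : Prop :=
  v != 0 /\ v *m A = l *: v.

End Local.

Section Global.
Variables (R : realType) (n : nat) (Q : topologicalType).
Variable M : smooth_structure R n Q.
Local Notation TV := 'rV[R]_(n + n).

Definition regular (L : chart M -> TV -> R) : Prop :=
  forall a x, Tdom a x -> hess (L a) x \in unitmx.

Definition euler_lagrange_field (L : chart M -> TV -> R)
    (G : chart M -> TV -> TV) : Prop :=
  vfield_on_TQ G /\
  forall a x, Tdom a x -> forall eta : TV,
    dform (dS (L a)) x (G a x) eta = - dfun (energy (L a)) x eta.

(* Differential identities for vector fields are required for all smooth fields
   on each chart domain. *)
Definition complete_lift (J : chart M -> 'rV[R]_n -> 'M[R]_n)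
    (Jc : chart M -> TV -> 'M[R]_(n + n)) : Prop :=
  tensor11_on_TQ Jc /\
  forall a (X : 'rV[R]_n -> 'rV[R]_n), smooth_on (cdom a) X ->
  forall x, Tdom a x ->
    clift X x *m Jc a x = clift (fun q => X q *m J a q) x /\
    vlift (X (lsubmx x)) *m Jc a x =
      vlift (X (lsubmx x) *m J a (lsubmx x)).

Definition g_transpose (L : chart M -> TV -> R)
    (J : chart M -> 'rV[R]_n -> 'M[R]_n) (Jbar : chart M -> TV -> 'M[R]_n) : Prop :=
  tensor11_along Jbar /\
  forall a x, Tdom a x -> forall v w : 'rV[R]_n,
    gL (L a) x (v *m J a (lsubmx x)) w = gL (L a) x v (w *m Jbar a x).

Definition U_tensor (L : chart M -> TV -> R) (G : chart M -> TV -> TV)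
    (J : chart M -> 'rV[R]_n -> 'M[R]_n) (U : chart M -> TV -> 'M[R]_n) : Prop :=
  tensor11_along U /\
  forall a (X Y : TV -> 'rV[R]_n),
    smooth_on (Tdom a) X -> smooth_on (Tdom a) Y ->
  forall x, Tdom a x ->
    gL (L a) x (X x *m U a x) (Y x) = dH (G a) (Jtheta (J a) (L a)) X Y x.

Definition R_tensor (L : chart M -> TV -> R)
    (Jc Rt : chart M -> TV -> 'M[R]_(n + n)) : Prop :=
  tensor11_on_TQ Rt /\
  forall a x, Tdom a x -> forall xi eta : TV,
    dform (dS (L a)) x (xi *m Rt a x) eta =
    dform (dJcS (Jc a) (L a)) x xi eta.

(* lam are functions on Q, pairwise distinct at every point. *)
Definition diagonalizable_with (J : chart M -> 'rV[R]_n -> 'M[R]_n)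
    (lam : 'I_n -> Q -> R) : Prop :=
  forall a q, cdom a q -> exists2 P : 'M[R]_n, P \in unitmx &
    similar P (J a q) (diag_mx (\row_i lam i (param a q))).

Definition eigenvector_along (A : chart M -> TV -> 'M[R]_n) (l : Q -> R)
    (X : chart M -> TV -> 'rV[R]_n) : Prop :=
  vfield_along X /\
  forall a x, Tdom a x ->
    is_eigenvector (A a x) (l (param a (lsubmx x))) (X a x).

End Global.

(* Main.v *)
Require Import Defs.
From HB Require Import structures.
From mathcomp Require Import all_boot all_order all_algebra.
From mathcomp Require Import all_classical all_reals all_analysis.
From mathcomp Require Import ring lra.
Set Implicit Arguments.
Unset Strict Implicit.
Unset Printing Implicit Defensive.
Import Order.TTheory GRing.Theory Num.Theory.
Import numFieldNormedType.Exports.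
Local Open Scope classical_set_scope.
Local Open Scope ring_scope.

(** Why the theorem holds. Fix a chart and split every tangent vector of TQ as
    a^H + b^V. Write theta_c for the derivative of L along (0, c), and kappa_c
    for the component J(theta_L)(c), which is theta_(Jc) with Jc depending on
    the base point. The values of d d_S L and d d_(J^c S) L on (xi, eta) are
    the antisymmetrised derivatives of theta, respectively kappa, and in the
    adapted frame they become
      d d_S L (a^H + b^V, c^H + d^V) = g(b, c) - g(d, a)
        ([dform_dS_adapted]),
      d d_(J^c S) L (a^H + b^V, c^H + d^V) = g(Ua, c) + g(b, Jc) - g(d, Ja)
        ([dform_dJcS_adapted]).
    The first formula says that horizontal vectors span a Lagrangian
    distribution for omega_L ([horizontal_lagrangian]); this is the vertical
    derivative of the Euler-Lagrange equations. The second one identifies the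
    horizontal-horizontal part with d^H(J theta_L): on fields with constant
    components, D^H_a c is a second vertical derivative of the force, so it is
    symmetric in a and c and drops out. Since g is nondegenerate, comparing
    the two formulas gives
      R (a^H + b^V) = (Ja)^H + (Ua + Jbar b)^V   ([Rt_adapted]),
    from which the two families of eigenvectors can be read off. They are
    independent because the components of Z_i^V and X_i^H + Y_i^V form a block
    antitriangular matrix with invertible blocks (Z_i) and (X_i).

    It remains to produce Y_i. The equation (lam_i - Jbar) Y = U X_i is
    singular, and the image of lam_i - Jbar is the g-orthogonal of X_i; as
    g(Ua, c) is skew, g(U X_i, X_i) = 0 and the equation is solvable
    ([solvability]). Solving it in the eigenbasis (Z_j), with Z_i-component
    set to zero, gives a canonical solution [eigen_solution]. It is the same
    in all charts, and it is smooth because the inverse of the matrix of the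
    Z_j is, and because the eigenvalues are diagonal entries of the smooth
    matrix Z Jbar Z^-1.

    All this rests on the calculus of functions having continuous iterated
    directional derivatives of all orders: closure under the algebraic
    operations, linearity of the derivative in its direction
    ([is_derive_lincomb]) and symmetry of second derivatives
    ([derive_comm]). *)

(** * Smooth functions on an open set *)

Section SmoothCalculus.
Context {R : realType} {V : normedModType R}.
Variable D : set V.
Hypothesis oD : open D.

Section Generic.
Context {W : normedModType R}.
Implicit Types f g : V -> W.

Lemma near_eq_on f g x : (forall y, D y -> f y = g y) -> D x ->
  \forall y \near x, f y = g y.
Proof.
move=> fg Dx; have := open_nbhs_nbhs (conj oD Dx).
by apply: filterS => y Dy; exact: fg.
Qed.

Lemma derive_eq_on f g x v : (forall y, D y -> f y = g y) -> D x ->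
  'D_v f x = 'D_v g x.
Proof. by move=> fg Dx; apply: near_eq_derive; exact: near_eq_on. Qed.

Lemma continuous_eq_on f g x : (forall y, D y -> f y = g y) -> D x ->
  {for x, continuous f} -> {for x, continuous g}.
Proof.
move=> fg Dx fc; rewrite /prop_for /continuous_at -(fg x Dx).
by apply: cvg_trans fc; apply: near_eq_cvg; apply: near_eq_on Dx => y /fg.
Qed.

Lemma derivable_eq_on f g x v : (forall y, D y -> f y = g y) -> D x ->
  derivable f x v -> derivable g x v.
Proof. by move=> fg Dx; apply: near_eq_derivable; exact: near_eq_on. Qed.

(** Openness of the domain makes being C^k insensitive to the values outside,
    so pointwise identities valid on the domain can be used for rewriting. *)
Lemma Ck_on_eq k f g : (forall y, D y -> f y = g y) ->
  Ck_on k D f -> Ck_on k D g.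
Proof.
move=> fg Cf; elim: k f g fg Cf => [|k IH] f g fg [fc fd].
  by split=> // x Dx; exact: (continuous_eq_on fg Dx (fc x Dx)).
split=> [x Dx|v]; first exact: (continuous_eq_on fg Dx (fc x Dx)).
have [df Cf] := fd v; split=> [x Dx|]; first exact: derivable_eq_on (df x Dx).
by apply: IH Cf => y Dy; exact: derive_eq_on.
Qed.

Lemma smooth_on_eq f g : (forall y, D y -> f y = g y) ->
  smooth_on D f -> smooth_on D g.
Proof. by move=> fg sf k; exact: Ck_on_eq (sf k). Qed.

Lemma Ck_onW k f : Ck_on k.+1 D f -> Ck_on k D f.
Proof.
elim: k f => [|k IH] f [fc fd]; split=> // v.
by have [df Cf] := fd v; split=> //; exact: IH.
Qed.

Lemma smooth_continuous f x : smooth_on D f -> D x -> {for x, continuous f}.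
Proof. by move=> /(_ 0) [fc _]; exact: fc. Qed.

Lemma smooth_derivable f x v : smooth_on D f -> D x -> derivable f x v.
Proof. by move=> /(_ 1) [_ /(_ v)[df _]]; exact: df. Qed.

Lemma smooth_derive f v : smooth_on D f -> smooth_on D (fun x => 'D_v f x).
Proof. by move=> sf k; have [_ /(_ v)[_]] := sf k.+1. Qed.

Lemma Ck_on_cst k (c : W) : Ck_on k D (fun=> c).
Proof.
elim: k c => [|k IH] c; first by split=> // x _; exact: cvg_cst.
split=> [x _|v]; first exact: cvg_cst.
split=> [x _|]; first exact: derivable_cst.
by apply: Ck_on_eq (IH 0) => y _; rewrite (derive_cst c).
Qed.

Lemma smooth_cst (c : W) : smooth_on D (fun=> c).
Proof. by move=> k; exact: Ck_on_cst. Qed.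

Lemma Ck_onD k f g : Ck_on k D f -> Ck_on k D g ->
  Ck_on k D (fun x => f x + g x).
Proof.
elim: k f g => [|k IH] f g [fc fd] [gc gd].
  by split=> // x Dx; apply: cvgD; [exact: fc|exact: gc].
split=> [x Dx|v]; first by apply: cvgD; [exact: fc|exact: gc].
have [df Cf] := fd v; have [dg Cg] := gd v; split=> [x Dx|].
  by apply: derivableD; [exact: df|exact: dg].
apply: Ck_on_eq (IH _ _ Cf Cg) => y Dy.
by rewrite (deriveD (df y Dy) (dg y Dy)).
Qed.

Lemma smoothD f g : smooth_on D f -> smooth_on D g ->
  smooth_on D (fun x => f x + g x).
Proof. by move=> sf sg k; exact: Ck_onD. Qed.

Lemma smooth_sum (I : Type) (r : seq I) (P : pred I) (F : I -> V -> W) :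
  (forall i, P i -> smooth_on D (F i)) ->
  smooth_on D (fun x => \sum_(i <- r | P i) F i x).
Proof.
move=> sF; elim: r => [|i r IH].
  by apply: smooth_on_eq (smooth_cst 0) => y _; rewrite big_nil.
have [Pi|nPi] := boolP (P i); last first.
  by apply: smooth_on_eq IH => y _; rewrite big_cons (negbTE nPi).
apply: smooth_on_eq (smoothD (sF i Pi) IH) => y _.
by rewrite big_cons Pi.
Qed.

End Generic.

Section Scalar.
Implicit Types f g : V -> R^o.

(** Leibniz: the derivative of a product is a sum of products of C^k
    functions, which is why the induction has to keep both C^(k+1) factors
    available as C^k ones. *)
Lemma Ck_onM k f g : Ck_on k D f -> Ck_on k D g ->
  Ck_on k D (fun x => f x * g x : R^o).
Proof.
elim: k f g => [|k IH] f g Cf Cg.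
  case: Cf Cg => fc fd [gc gd]; split=> // x Dx.
  by apply: cvgM; [exact: fc|exact: gc].
have [fc fd] := Cf; have [gc gd] := Cg; split=> // [x Dx|v].
  by apply: cvgM; [exact: fc|exact: gc].
have [df Cdf] := fd v; have [dg Cdg] := gd v; split=> [x Dx|].
  by apply: derivableM; [exact: df|exact: dg].
apply: Ck_on_eq (Ck_onD (IH _ _ (Ck_onW Cf) Cdg)
                        (IH _ _ (Ck_onW Cg) Cdf)) => y Dy.
by rewrite (deriveM (df y Dy) (dg y Dy)).
Qed.

Lemma smoothM f g : smooth_on D f -> smooth_on D g ->
  smooth_on D (fun x => f x * g x : R^o).
Proof. by move=> sf sg k; exact: Ck_onM. Qed.

Lemma smoothN f : smooth_on D f -> smooth_on D (fun x => - f x : R^o).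
Proof.
move=> sf; apply: smooth_on_eq (smoothM (smooth_cst (-1 : R^o)) sf) => y _.
by rewrite mulN1r.
Qed.

Lemma smooth_prod (I : Type) (r : seq I) (P : pred I) (F : I -> V -> R^o) :
  (forall i, P i -> smooth_on D (F i)) ->
  smooth_on D (fun x => \prod_(i <- r | P i) (F i x : R) : R^o).
Proof.
move=> sF; elim: r => [|i r IH].
  by apply: smooth_on_eq (smooth_cst (1 : R^o)) => y _; rewrite big_nil.
have [Pi|nPi] := boolP (P i); last first.
  by apply: smooth_on_eq IH => y _; rewrite big_cons (negbTE nPi).
apply: smooth_on_eq (smoothM (sF i Pi) IH) => y _.
by rewrite big_cons Pi.
Qed.

Lemma Ck_onV k f : (forall x, D x -> f x != 0) -> Ck_on k D f ->
  Ck_on k D (fun x => (f x : R)^-1 : R^o).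
Proof.
move=> f0; elim: k => [|k IH] Cf.
  case: Cf => fc _; split=> // x Dx.
  by apply: cvgV; [exact: f0|exact: fc].
have [fc fd] := Cf; split=> // [x Dx|v].
  by apply: cvgV; [exact: f0|exact: fc].
have [df Cdf] := fd v; split=> [x Dx|].
  by apply: derivableV; [exact: f0|exact: df].
have Ci := IH (Ck_onW Cf).
apply: Ck_on_eq (Ck_onM (Ck_on_cst k (-1 : R^o))
   (Ck_onM (Ck_onM Ci Ci) Cdf)) => y Dy.
rewrite (deriveV (f0 y Dy) (df y Dy)) /GRing.scale /= mulN1r -exprVn expr2.
by rewrite mulNr.
Qed.

Lemma smoothV f : (forall x, D x -> f x != 0) -> smooth_on D f ->
  smooth_on D (fun x => (f x : R)^-1 : R^o).
Proof. by move=> f0 sf k; exact: Ck_onV. Qed.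

End Scalar.

Section Matrices.

Lemma continuous_mxP m p (A : V -> 'M[R]_(m, p)) x :
  {for x, continuous A} <->
  forall i j, {for x, continuous (fun y => A y i j : R^o)}.
Proof.
split=> [Ac i j|Ac].
  apply: (@continuous_comp _ _ _ A (fun B : 'M[R]_(m, p) => B i j : R^o)) => //.
  exact: coord_continuous.
apply/cvgrPdist_le => /= e e0.
near=> y.
rewrite /Num.Def.normr/= mx_normrE (bigmax_le _ (ltW e0))//= => i _.
rewrite !mxE/=.
move: i; near: y; apply: filter_forall => /= i.
exact: ((cvgrPdist_le _ _).1 (Ac i.1 i.2)).
Unshelve. all: by end_near. Qed.

Lemma Ck_on_mxP k m p (A : V -> 'M[R]_(m, p)) :
  Ck_on k D A <-> forall i j, Ck_on k D (fun y => A y i j : R^o).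
Proof.
elim: k A => [|k IH] A; split.
- move=> [Ac _] i j; split=> // x Dx.
  exact: (continuous_mxP _ _).1 (Ac x Dx) i j.
- by move=> AC; split=> // x Dx; apply/continuous_mxP => i j; exact: (AC i j).1.
- move=> [Ac Ad] i j; split=> [x Dx|v].
    exact: (continuous_mxP _ _).1 (Ac x Dx) i j.
  have [dA CA] := Ad v; split=> [x Dx|].
    exact: (derivable_mxP _ _ _).1 (dA x Dx) i j.
  apply: Ck_on_eq ((IH _).1 CA i j) => y Dy.
  by rewrite (derive_mx (dA y Dy)) mxE.
- move=> AC; split=> [x Dx|v].
    by apply/continuous_mxP => i j; exact: (AC i j).1.
  have dA x : D x -> derivable A x v.
    move=> Dx; apply/derivable_mxP => i j.
    by have [_ /(_ v)[dij _]] := AC i j; exact: dij.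
  split=> //; apply/IH => i j; have [_ /(_ v)[_ Cij]] := AC i j.
  apply: Ck_on_eq Cij => y Dy.
  by rewrite (derive_mx (dA y Dy)) mxE.
Qed.

Lemma smooth_mxP m p (A : V -> 'M[R]_(m, p)) :
  smooth_on D A <-> forall i j, smooth_on D (fun y => A y i j : R^o).
Proof.
split=> [sA i j k|sA k]; first exact: (Ck_on_mxP _ _).1 (sA k) i j.
by apply/Ck_on_mxP => i j; exact: sA.
Qed.

Lemma smooth_mulmx m p q (A : V -> 'M[R]_(m, p)) (B : V -> 'M[R]_(p, q)) :
  smooth_on D A -> smooth_on D B -> smooth_on D (fun x => A x *m B x).
Proof.
move=> /smooth_mxP sA /smooth_mxP sB; apply/smooth_mxP => i j.
pose AB x : R^o := \sum_k (A x i k * B x k j : R^o).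
apply: (smooth_on_eq (f := AB)) => [y _|].
  by rewrite mxE.
by apply: smooth_sum => k _; exact: smoothM.
Qed.

Lemma smooth_det m (A : V -> 'M[R]_m) :
  smooth_on D A -> smooth_on D (fun x => \det (A x) : R^o).
Proof.
move=> /smooth_mxP sA; apply: smooth_sum => s _.
by apply: smoothM; [exact: smooth_cst|apply: smooth_prod => i _; exact: sA].
Qed.

(** Cramer's rule: the entries of the inverse are cofactors over the
    determinant. *)
Lemma smooth_invmx m (A : V -> 'M[R]_m) : (forall x, D x -> A x \in unitmx) ->
  smooth_on D A -> smooth_on D (fun x => invmx (A x)).
Proof.
move=> uA sA; apply/smooth_mxP => i j.
pose C x : 'M[R]_m.-1 := row' j (col' i (A x)).
apply: (smooth_on_eq
  (f := fun x => (\det (A x))^-1 * ((-1) ^+ (j + i) * \det (C x)) : R^o)).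
  by move=> y Dy; rewrite /invmx uA // !mxE /cofactor.
apply: smoothM.
  apply: smoothV (smooth_det sA) => x Dx.
  by rewrite -unitfE; exact: uA.
apply: smoothM (smooth_cst _) _; apply: smooth_det; apply/smooth_mxP => k l.
move/smooth_mxP: sA => /(_ (lift j k) (lift i l)); apply: smooth_on_eq => y _.
by rewrite !mxE.
Qed.

End Matrices.
End SmoothCalculus.

(** * Linearity and symmetry of directional derivatives *)

Lemma close_to_common {R : realFieldType} (S k a b e : R) : 0 < k ->
  `|S - k * a| <= k * (e / 2) -> `|S - k * b| <= k * (e / 2) -> `|a - b| <= e.
Proof.
move=> k0 A B; rewrite -(ler_pM2l k0) -{1}(gtr0_norm k0) -normrM mulrBr.
rewrite (le_trans (ler_distD S _ _)) // [e in leRHS]splitr mulrDr lerD //.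
by rewrite distrC.
Qed.

Section Directional.
Context {R : realType} {V : normedModType R}.
Implicit Types (f : V -> R^o) (x y v w : V).

Lemma is_derive_line f y v (s : R) : derivable f (s *: v + y) v ->
  is_derive s 1 (fun t : R => f (t *: v + y) : R^o) ('D_v f (s *: v + y)).
Proof.
have E : (fun h : R =>
     h^-1 *: (f ((h *: (1 : R^o) + s) *: v + y) - f (s *: v + y)))
   = (fun h : R => h^-1 *: (f (h *: v + (s *: v + y)) - f (s *: v + y))).
  by apply/funext => h; rewrite [h *: 1]mulr1 scalerDl addrA.
by move=> df; split; rewrite /derivable /derive /= E.
Qed.

(** The mean value theorem along a line; allowing either sign of [t] is what
    makes it usable for two-sided limits. *)
Lemma MVT_line f y v (t : R) :
  (forall s : R, `|s| <= `|t| -> derivable f (s *: v + y) v) ->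
  exists2 s : R, `|s| <= `|t| &
    f (t *: v + y) - f y = t * 'D_v f (s *: v + y).
Proof.
move=> df; pose phi (s : R) : R^o := f (s *: v + y).
pose dphi (s : R) : R := 'D_v f (s *: v + y).
have dphiP (s : R) : `|s| <= `|t| -> is_derive s 1 phi (dphi s).
  by move=> /df; exact: is_derive_line.
have cphi a b : (forall s : R, s \in `[a, b] -> `|s| <= `|t|) ->
    {within `[a, b], continuous phi}.
  move=> ab; apply: derivable_within_continuous => s /ab/dphiP ds.
  exact: ex_derive.
case: (ltgtP t 0) => [t0|t0|->]; last 1 first.
- by exists 0; rewrite // mul0r scale0r add0r subrr.
- have bnd (s : R) : s \in `[t, 0] -> `|s| <= `|t|.
    by move=> /itvP st; rewrite !ler0_norm ?lerN2 ?st // ltW.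
  have dI (s : R) : s \in `]t, 0[ -> is_derive s 1 phi (dphi s).
    by move=> sI; apply: dphiP; apply: bnd; apply: subset_itv_oo_cc.
  have [s sI] := MVT t0 dI (cphi _ _ bnd).
  rewrite /phi scale0r add0r sub0r => fE; exists s.
    by apply: bnd; apply: subset_itv_oo_cc.
  by rewrite -opprB fE mulrN opprK mulrC.
- have bnd (s : R) : s \in `[0, t] -> `|s| <= `|t|.
    by move=> /itvP st; rewrite !ger0_norm ?st // ltW.
  have dI (s : R) : s \in `]0, t[ -> is_derive s 1 phi (dphi s).
    by move=> sI; apply: dphiP; apply: bnd; apply: subset_itv_oo_cc.
  have [s sI] := MVT t0 dI (cphi _ _ bnd).
  rewrite /phi scale0r add0r subr0 => fE; exists s.
    by apply: bnd; apply: subset_itv_oo_cc.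
  by rewrite fE mulrC.
Qed.

Section Open.
Variable D : set V.
Hypothesis oD : open D.

Lemma near_parallelogram (P : V -> Prop) x v w : (\forall y \near x, P y) ->
  exists2 r : R, 0 < r & forall s t : R, `|s| <= r -> `|t| <= r ->
    P (s *: v + (t *: w + x)).
Proof.
move=> /nbhs_ballP[e /= e0 Pe].
pose K : R := `|v| + `|w| + 1.
have K0 : 0 < K by rewrite ltr_wpDl // addr_ge0.
exists (e / (2 * K)) => [|s t sr tr]; first by rewrite divr_gt0 // mulr_gt0.
apply: Pe; rewrite -ball_normE /= addrA opprD addrCA subrr addr0 normrN.
rewrite (le_lt_trans (ler_normD _ _)) // !normrZ.
have r0 : 0 <= e / (2 * K) by rewrite divr_ge0 // ?mulr_ge0 // ltW.
have : `|s| * `|v| + `|t| * `|w| <= e / (2 * K) * K.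
  rewrite /K mulrDr mulrDr mulr1.
  have := ler_wpM2r (normr_ge0 v) sr; have := ler_wpM2r (normr_ge0 w) tr.
  by move=> A B; rewrite -[leLHS]addr0 lerD // lerD.
move=> /le_lt_trans; apply.
rewrite invfM mulrA -mulrA mulVf ?gt_eqF // mulr1.
by rewrite ltr_pdivrMr // ltr_pMr // ltrDl.
Qed.

(** Splitting the increment along [c *: v + w] into a step along [w] and a step
    along [v], the first quotient converges by derivability and the second is,
    by the mean value theorem, [c] times a nearby value of the derivative along
    [v], which is continuous. *)
Lemma is_derive_lincomb f x v w (c : R) : D x ->
  (forall y, D y -> derivable f y v) ->
  {for x, continuous (fun y => 'D_v f y)} ->
  derivable f x w ->
  is_derive x (c *: v + w) f (c * 'D_v f x + 'D_w f x).
Proof.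
move=> Dx df cdf dw.
suff H : (fun h => h^-1 *: (f (h *: (c *: v + w) + x) - f x)) @ 0^' -->
    (c * 'D_v f x + 'D_w f x : R^o).
  by split; [apply/cvg_ex; eexists; exact: H|exact: cvg_lim H].
(* q is the quotient of the step along w, p that of the step along v. *)
pose q (h : R) : R^o := h^-1 *: (f (h *: w + x) - f x).
pose p (h : R) : R^o :=
  h^-1 *: (f ((h * c) *: v + (h *: w + x)) - f (h *: w + x)).
have -> : (fun h : R => h^-1 *: (f (h *: (c *: v + w) + x) - f x)) =
          (fun h => p h + q h).
  apply/funext => h; rewrite /p /q -[RHS]scalerDr addrA subrK.
  by rewrite [h *: (_ + _)]scalerDr scalerA addrA.
apply: cvgD; last exact: dw.
apply/cvgrPdist_le => /= e e0.
have c1 : 0 < `|c| + 1 by rewrite ltr_wpDl.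
have nP : \forall y \near x, D y /\ `|'D_v f x - 'D_v f y| <= e / (`|c| + 1).
  near=> y; split.
    by near: y; exact: (open_nbhs_nbhs (conj oD Dx)).
  by near: y; move/cvgrPdist_le : cdf; apply; rewrite divr_gt0.
have [r r0 rP] := near_parallelogram v w nP.
have rc : 0 < r / (`|c| + 1) by rewrite divr_gt0.
near=> h.
have h0 : h != 0 by near: h; exact: nbhs_dnbhs_neq.
have hr : `|h| <= r / (`|c| + 1) by near: h; exact: dnbhs0_le.
have hr1 : `|h| <= r.
  by rewrite (le_trans hr) // ler_pdivrMr // ler_pMr // lerDr.
have hr2 : `|h * c| <= r.
  rewrite normrM (le_trans (ler_wpM2r _ hr)) // mulrAC ler_pdivrMr //.
  by rewrite ler_wpM2l ?(ltW r0) // lerDl.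
have [s sh pE] := @MVT_line f (h *: w + x) v (h * c)
  (fun s sh => df _ (rP s h (le_trans sh hr2) hr1).1).
rewrite /p pE /GRing.scale /= -mulrA mulKf // -mulrBr normrM.
have [_ H] := rP s h (le_trans sh hr2) hr1.
rewrite (le_trans (ler_wpM2l _ H)) // mulrCA ler_piMr ?(ltW e0) //.
by rewrite ler_pdivrMr // mul1r lerDl.
Unshelve. all: by end_near. Qed.

(** Two applications of the mean value theorem: the increment along [v] of the
    increment of [f] along [h *: w]. The second difference itself is symmetric
    in [v] and [w], whence [derive_comm]. *)
Lemma second_difference f x v w : D x ->
  (forall y, D y -> derivable f y v) ->
  (forall y, D y -> derivable (fun z => 'D_v f z : R^o) y w) ->
  {for x, continuous (fun y => 'D_w (fun z => 'D_v f z : R^o) y)} ->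
  forall e : R, 0 < e -> \forall h \near (0 : R)^'+,
  `|(f (h *: v + (h *: w + x)) - f (h *: w + x) - f (h *: v + x) + f x)
     - h ^+ 2 * 'D_w (fun z => 'D_v f z : R^o) x| <= h ^+ 2 * e.
Proof.
move=> Dx dv dwv cwv e e0.
have nP : \forall y \near x, D y /\
   `|'D_w (fun z => 'D_v f z : R^o) x - 'D_w (fun z => 'D_v f z : R^o) y| <= e.
  near=> y; split.
    by near: y; exact: (open_nbhs_nbhs (conj oD Dx)).
  by near: y; move/cvgrPdist_le : cwv; apply.
have [r r0 rP] := near_parallelogram w v nP.
near=> h.
have h0 : 0 < h by [].
have hr : `|h| <= r by rewrite gtr0_norm //; near: h; exact: nbhs_right_le.
pose F y : R^o := f (h *: w + y) - f y.
have dshift y :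
  (fun t : R => t^-1 *:
     ((f \o shift (h *: w + y)) (t *: v) - f (h *: w + y))) =
  (fun t : R => t^-1 *:
     (((fun z => f (h *: w + z) : R^o) \o shift y) (t *: v)
      - f (h *: w + y))).
  by apply/funext => t /=; rewrite addrCA.
have DF (s : R) : `|s| <= `|h| ->
    is_derive (s *: v + x) v F
      ('D_v f (h *: w + (s *: v + x)) - 'D_v f (s *: v + x)).
  move=> sh.
  have D1 : D (h *: w + (s *: v + x)) by apply: (rP _ _ hr (le_trans sh hr)).1.
  have D0 : D (s *: v + x).
    have := (rP 0 s _ (le_trans sh hr)).1.
    by rewrite scale0r add0r normr0; apply; exact: ltW.
  apply: (is_deriveB (f := fun z => f (h *: w + z) : R^o) (g := f)).
    by split; [rewrite /derivable -dshift; exact: dv|rewrite /derive -dshift].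
  by split; [exact: dv|].
have [s sh] :=
  @MVT_line F x v h (fun s sh => @ex_derive _ _ _ _ _ _ _ (DF s sh)).
rewrite (@derive_val _ _ _ _ _ _ _ (DF s sh)).
have [|s' s'h ->] := @MVT_line (fun z => 'D_v f z : R^o) (s *: v + x) w h.
  move=> s' s'h; apply: dwv.
  exact: (rP _ _ (le_trans s'h hr) (le_trans sh hr)).1.
rewrite /F [h *: w + _]addrCA mulrA -expr2 => E.
have -> : f (h *: v + (h *: w + x)) - f (h *: w + x) - f (h *: v + x) + f x =
  h ^+ 2 * 'D_w (fun z => 'D_v f z : R^o) (s' *: w + (s *: v + x)).
  by rewrite -E opprB -!addrA; congr (_ + _); rewrite addrC -addrA.
rewrite -mulrBr normrM ger0_norm ?sqr_ge0 // ler_wpM2l ?sqr_ge0 // distrC.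
exact: (rP _ _ (le_trans s'h hr) (le_trans sh hr)).2.
Unshelve. all: by end_near. Qed.

Lemma derive_comm f x v w : smooth_on D f -> D x ->
  'D_v (fun z => 'D_w f z : R^o) x = 'D_w (fun z => 'D_v f z : R^o) x.
Proof.
move=> sf Dx.
have sd u := smooth_derive u sf.
have H u u' := @second_difference f x u u' Dx
   (fun y Dy => smooth_derivable sf Dy)
   (fun y Dy => smooth_derivable (sd u) Dy)
   (smooth_continuous (smooth_derive u' (sd u)) Dx).
apply/eqP; rewrite -subr_eq0 -normr_le0; apply/ler_addgt0Pr => e e0.
rewrite add0r.
have e2 : 0 < e / 2 by rewrite divr_gt0.
suff [h [h0 A B]] : exists h : R, [/\ 0 < h,
  `|(f (h *: v + (h *: w + x)) - f (h *: w + x) - f (h *: v + x) + f x)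
     - h ^+ 2 * 'D_w (fun z => 'D_v f z : R^o) x| <= h ^+ 2 * (e / 2) &
  `|(f (h *: w + (h *: v + x)) - f (h *: v + x) - f (h *: w + x) + f x)
     - h ^+ 2 * 'D_v (fun z => 'D_w f z : R^o) x| <= h ^+ 2 * (e / 2)].
  apply: close_to_common (exprn_gt0 2 h0) _ A.
  by move: B; rewrite [h *: w + (_ + _)]addrCA (addrAC (f (h *: v + _))).
have [h [[h0 A] B]] := filter_ex (filterI (filterI (nbhs_right_gt (0 : R))
  (H v w _ e2)) (H w v _ e2)).
by exists h; split; [exact: h0|exact: A|exact: B].
Qed.

End Open.
End Directional.

Section LinearDirections.
Context {R : realType} {V : normedModType R}.
Variable D : set V.
Hypothesis oD : open D.
Implicit Types (F : V -> R^o) (x y v w : V).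

Lemma derive_lincomb F x v w (c : R) : smooth_on D F -> D x ->
  'D_(c *: v + w) F x = c * 'D_v F x + 'D_w F x.
Proof.
move=> sF Dx; have H : is_derive x (c *: v + w) F (c * 'D_v F x + 'D_w F x).
  apply: (is_derive_lincomb oD) => //.
  - by move=> y Dy; exact: smooth_derivable sF Dy.
  - by apply: smooth_continuous Dx; exact: smooth_derive.
  - exact: smooth_derivable sF Dx.
exact: (@derive_val _ _ _ _ _ _ _ H).
Qed.

Lemma derive_dirD F x v w : smooth_on D F -> D x ->
  'D_(v + w) F x = 'D_v F x + 'D_w F x.
Proof.
by move=> sF Dx; rewrite -[v]scale1r derive_lincomb // mul1r scale1r.
Qed.

Lemma derive_dirZ F x v (c : R) : smooth_on D F -> D x ->
  'D_(c *: v) F x = c * 'D_v F x.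
Proof.
by move=> sF Dx; rewrite -[_ *: v]addr0 derive_lincomb // derive0 addr0.
Qed.

Lemma derive_dirB F x v w : smooth_on D F -> D x ->
  'D_(v - w) F x = 'D_v F x - 'D_w F x.
Proof.
by move=> sF Dx; rewrite addrC -scaleN1r derive_lincomb // mulN1r addrC.
Qed.

Lemma derive_dir_sum (I : finType) F x (c : I -> R) (u : I -> V) :
  smooth_on D F -> D x ->
  'D_(\sum_i c i *: u i) F x = \sum_i c i * 'D_(u i) F x.
Proof.
move=> sF Dx; elim/big_rec2: _ => [|i s v _ IH]; first exact: derive0.
by rewrite derive_lincomb // IH.
Qed.

End LinearDirections.

(** * Derivatives of composite expressions on row vectors *)

Section MovingDirection.
Context {R : realType} {N : nat}.
Local Notation V := 'rV[R]_N.
Variable D : set V.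
Hypothesis oD : open D.
Implicit Types (F : V -> R^o) (A : V -> V) (x y v w : V).

Lemma derive_row F x v : smooth_on D F -> D x ->
  'D_v F x = \sum_k v 0 k * 'D_(delta_mx 0 k) F x.
Proof.
by move=> sF Dx; rewrite {1}[v]row_sum_delta (derive_dir_sum oD).
Qed.

Lemma smooth_moving F A : smooth_on D F -> smooth_on D A ->
  smooth_on D (fun y => 'D_(A y) F y : R^o).
Proof.
move=> sF sA.
apply: (smooth_on_eq oD
  (f := fun y => \sum_k (A y 0 k * 'D_(delta_mx 0 k) F y : R^o))).
  by move=> y Dy; rewrite -derive_row.
apply: (smooth_sum oD) => k _; apply: (smoothM oD).
  by have /(smooth_mxP oD) := sA; apply.
exact: smooth_derive.
Qed.

(** Product rule for a derivative taken in a variable direction: by linearity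
    in the direction it is a finite sum of products. It is used for the energy,
    for the components of [J theta_L] and for the Euler-Lagrange equations. *)
Lemma derive_moving F A x v : smooth_on D F -> smooth_on D A -> D x ->
  'D_v (fun y => 'D_(A y) F y : R^o) x =
  'D_('D_v A x) F x + 'D_v (fun y => 'D_(A x) F y : R^o) x.
Proof.
move=> sF sA Dx.
have dF k : derivable (fun y => 'D_(delta_mx 0 k) F y : R^o) x v.
  exact: smooth_derivable (smooth_derive _ sF) Dx.
have dA k : derivable (fun y => A y 0 k : R^o) x v.
  by have /(smooth_mxP oD) sAk := sA; exact: smooth_derivable (sAk 0 k) Dx.
have dAF (c : 'I_N -> V -> R^o) :
    (forall k, derivable (c k) x v) ->
    'D_v (fun y => \sum_k (c k y * 'D_(delta_mx 0 k) F y) : R^o) x =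
    \sum_k (c k x * 'D_v (fun y => 'D_(delta_mx 0 k) F y : R^o) x
            + 'D_(delta_mx 0 k) F x * 'D_v (c k) x).
  move=> dc.
  pose h k : V -> R^o := (c k : V -> R) * (fun y => 'D_(delta_mx 0 k) F y).
  have -> : (fun y => \sum_k (c k y * 'D_(delta_mx 0 k) F y) : R^o) =
            \sum_k h k.
    by apply/funext => y; rewrite fct_sumE.
  rewrite derive_sum => [|k]; last exact: derivableM.
  by apply: eq_bigr => k _; rewrite deriveM.
pose rowsum (c : 'I_N -> V -> R^o) y : R^o :=
  \sum_k (c k y * 'D_(delta_mx 0 k) F y).
have E1 : 'D_v (fun y => 'D_(A y) F y : R^o) x =
          'D_v (rowsum (fun k y => A y 0 k)) x.
  by apply: derive_eq_on Dx => // y Dy; rewrite derive_row.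
have E2 : 'D_v (fun y => 'D_(A x) F y : R^o) x =
          'D_v (rowsum (fun k _ => A x 0 k)) x.
  by apply: derive_eq_on Dx => // y Dy; rewrite derive_row.
rewrite E1 E2 /rowsum (dAF (fun k y => A y 0 k)) //.
rewrite (dAF (fun k _ => A x 0 k)) => [|k]; last exact: derivable_cst.
rewrite [in RHS](derive_row _ sF Dx) -big_split /=; apply: eq_bigr => k _.
rewrite (derive_mx (smooth_derivable sA Dx)) mxE (derive_cst (A x 0 k : R^o)).
by rewrite [_ * 0]mulr0 addr0 [RHS]addrC; congr (_ + _); exact: mulrC.
Qed.

End MovingDirection.

Section MatrixDerivatives.
Context {R : realType} {V : normedModType R}.
Variable D : set V.
Hypothesis oD : open D.

Lemma smooth_row_mx m p q (A : V -> 'M[R]_(m, p)) (B : V -> 'M[R]_(m, q)) :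
  smooth_on D A -> smooth_on D B -> smooth_on D (fun y => row_mx (A y) (B y)).
Proof.
move=> /(smooth_mxP oD) sA /(smooth_mxP oD) sB; apply/(smooth_mxP oD) => i j.
case: (split_ordP j) => k ->.
  by apply: smooth_on_eq (sA i k) => // y _; rewrite row_mxEl.
by apply: smooth_on_eq (sB i k) => // y _; rewrite row_mxEr.
Qed.

Lemma derive_row_mx m p q (A : V -> 'M[R]_(m, p)) (B : V -> 'M[R]_(m, q)) x v :
  derivable A x v -> derivable B x v ->
  'D_v (fun y => row_mx (A y) (B y)) x = row_mx ('D_v A x) ('D_v B x).
Proof.
move=> dA dB; have dAB : derivable (fun y => row_mx (A y) (B y)) x v.
  apply/derivable_mxP => i j; case: (split_ordP j) => k ->.
    by under eq_fun do rewrite row_mxEl; exact: (derivable_mxP _ _ _).1.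
  by under eq_fun do rewrite row_mxEr; exact: (derivable_mxP _ _ _).1.
rewrite (derive_mx dAB) (derive_mx dA) (derive_mx dB).
apply/matrixP => i j; rewrite mxE; case: (split_ordP j) => k ->.
  by rewrite row_mxEl mxE; under eq_fun do rewrite row_mxEl.
by rewrite row_mxEr mxE; under eq_fun do rewrite row_mxEr.
Qed.

Lemma smooth_rsubmx m p q (A : V -> 'M[R]_(m, p + q)) :
  smooth_on D A -> smooth_on D (fun y => rsubmx (A y)).
Proof.
move=> /(smooth_mxP oD) sA; apply/(smooth_mxP oD) => i j.
by apply: smooth_on_eq (sA i (rshift p j)) => // y _; rewrite mxE.
Qed.

Lemma smooth_id : smooth_on D (fun y => y).
Proof.
case=> [|k]; first by split=> // x _; exact: cvg_id.
split=> [x _|v]; first exact: cvg_id.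
split=> [x _|]; first exact: derivable_id.
apply: (Ck_on_eq oD (f := fun=> v)); last exact: smooth_cst.
by move=> y _; rewrite derive_id.
Qed.

Lemma derive_lsubmx m p q (A : V -> 'M[R]_(m, p + q)) x v : derivable A x v ->
  'D_v (fun y => lsubmx (A y)) x = lsubmx ('D_v A x).
Proof.
move=> dA; have dl : derivable (fun y => lsubmx (A y)) x v.
  apply/derivable_mxP => i j; under eq_fun do rewrite mxE.
  exact: (derivable_mxP _ _ _).1.
rewrite (derive_mx dA) (derive_mx dl); apply/matrixP => i j; rewrite !mxE.
by under eq_fun do rewrite mxE.
Qed.

Lemma derive_rsubmx m p q (A : V -> 'M[R]_(m, p + q)) x v : derivable A x v ->
  'D_v (fun y => rsubmx (A y)) x = rsubmx ('D_v A x).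
Proof.
move=> dA; have dl : derivable (fun y => rsubmx (A y)) x v.
  apply/derivable_mxP => i j; under eq_fun do rewrite mxE.
  exact: (derivable_mxP _ _ _).1.
rewrite (derive_mx dA) (derive_mx dl); apply/matrixP => i j; rewrite !mxE.
by under eq_fun do rewrite mxE.
Qed.

End MatrixDerivatives.

Section BaseFunctions.
Context {R : realType} {p q : nat} {W : normedModType R}.
Variable D0 : set 'rV[R]_p.
Local Notation D := [set x : 'rV[R]_(p + q) | D0 (lsubmx x)].

Lemma open_over : open D0 -> open D.
Proof.
by move=> oD0; apply: open_comp oD0 => x _; exact: continuous_lsubmx.
Qed.

Lemma quotient_over (f : 'rV[R]_p -> W) (x v : 'rV[R]_(p + q)) :
  (fun h : R => h^-1 *:
     (((fun y => f (lsubmx y)) \o shift x) (h *: v) - f (lsubmx x))) =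
  (fun h : R => h^-1 *:
     ((f \o shift (lsubmx x)) (h *: lsubmx v) - f (lsubmx x))).
Proof. by apply/funext => h; rewrite /= (linearP (@lsubmx R 1 p q)). Qed.

Lemma derive_over (f : 'rV[R]_p -> W) (x v : 'rV[R]_(p + q)) :
  'D_v (fun y => f (lsubmx y)) x = 'D_(lsubmx v) f (lsubmx x).
Proof.
by rewrite /derive quotient_over.
Qed.

Lemma smooth_over (f : 'rV[R]_p -> W) : open D0 -> smooth_on D0 f ->
  smooth_on D (fun y => f (lsubmx y)).
Proof.
move=> oD0 sf k; elim: k f sf => [|k IH] f sf; have [fc fd] := sf 1.
  split=> // x Dx; apply: continuous_comp; first exact: continuous_lsubmx.
  exact: fc.
split=> [x Dx|v].
  by apply: continuous_comp; [exact: continuous_lsubmx|exact: fc].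
split=> [x Dx|].
  by rewrite /derivable quotient_over; exact: (fd (lsubmx v)).1 _ Dx.
apply: Ck_on_eq (IH _ (smooth_derive (lsubmx v) sf)); first exact: open_over.
by move=> y _; rewrite derive_over.
Qed.

End BaseFunctions.

(** * The Euler-Lagrange connection is Lagrangian *)

Lemma antisym_cancel {R : realFieldType} (p q r s t : R) :
  2 * p - r + t = s -> 2 * q - s + t = r -> p = q.
Proof. by move=> E1 E2; lra. Qed.

Section LagrangianGeometry.
Context {R : realType} {n : nat}.
Local Notation TV := 'rV[R]_(n + n).
Variable D0 : set 'rV[R]_n.
Hypothesis oD0 : open D0.
Local Notation D := [set x : TV | D0 (lsubmx x)].
Implicit Types (x y xi eta : TV) (a b c d v w : 'rV[R]_n).

Let oD : open D := open_over oD0.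

Definition basedir c : TV := row_mx c 0.

Lemma vlift_lincomb (k : R) v w : vlift (k *: v + w) = k *: vlift v + vlift w.
Proof. by rewrite /vlift scale_row_mx add_row_mx scaler0 addr0. Qed.

Lemma vlift0 : vlift 0 = 0 :> TV.
Proof. by rewrite /vlift row_mx0. Qed.

Lemma vlift_sum v : vlift v = \sum_i v 0 i *: vlift (delta_mx 0 i).
Proof.
rewrite {1}[v]row_sum_delta; elim/big_rec2: _ => [|i s s' _ IH].
  exact: vlift0.
by rewrite vlift_lincomb IH.
Qed.

Lemma lsub_vlift v : lsubmx (vlift v) = 0.
Proof. by rewrite /vlift row_mxKl. Qed.

Lemma mul_vertical_endo xi : xi *m vertical_endo R n = vlift (lsubmx xi).
Proof.
by rewrite -{1}[xi]hsubmxK /vertical_endo mul_row_block !mulmx0 mulmx1 !addr0.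
Qed.

Section Lagrangian.
Variable L : TV -> R.
Hypothesis sL : smooth_on D (L : TV -> R^o).

Local Notation theta c := (fun y => theta_along L y c : R^o).

Lemma smooth_theta c : smooth_on D (theta c).
Proof. exact: (smooth_derive (vlift c) sL). Qed.
Hint Resolve smooth_theta : core.

Lemma theta0 y : theta_along L y 0 = 0.
Proof. by rewrite /theta_along /dfun vlift0 derive0. Qed.

Lemma dform_dSE x xi eta : dform (dS L) x xi eta =
  'D_xi (theta (lsubmx eta)) x - 'D_eta (theta (lsubmx xi)) x.
Proof.
have -> : dS L = fun y zeta => theta_along L y (lsubmx zeta); last by [].
apply/funext => y; apply/funext => zeta.
by rewrite /dS /dK mul_vertical_endo.
Qed.

(** The polarised form of the Hessian, with theta in place of coordinates; the
    symmetry of [g] is then that of second derivatives. *)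
Lemma gLE x v w : D x -> gL L x v w = 'D_(vlift v) (theta w) x.
Proof.
move=> Dx; rewrite (vlift_sum v) (derive_dir_sum oD) // /gL -mulmxA mxE.
apply: eq_bigr => i _.
congr (_ * _).
have thE y : D y ->
    \sum_j w 0 j * theta_along L y (delta_mx 0 j) = theta_along L y w.
  by move=> Dy; rewrite /theta_along /dfun (vlift_sum w) (derive_dir_sum oD).
pose h j : TV -> R^o := w 0 j *: (theta (delta_mx 0 j)).
have hE j : is_derive x (vlift (delta_mx 0 i)) (h j) (w 0 j * hess L x i j).
  have dj : derivable (theta (delta_mx 0 j)) x (vlift (delta_mx 0 i)).
    exact: smooth_derivable Dx.
  split; first exact: derivableZ.
  by rewrite deriveZ // mxE.
have -> : 'D_(vlift (delta_mx 0 i)) (theta w) x =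
          'D_(vlift (delta_mx 0 i)) (\sum_j h j) x.
  by apply: (derive_eq_on oD) Dx => y Dy; rewrite fct_sumE -thE.
rewrite derive_sum => [|j]; last exact: (@ex_derive _ _ _ _ _ _ _ (hE j)).
rewrite mxE; apply: eq_bigr => j _.
by rewrite (@derive_val _ _ _ _ _ _ _ (hE j)) !mxE mulrC.
Qed.

Lemma gLC x v w : D x -> gL L x v w = gL L x w v.
Proof.
move=> Dx; rewrite (gLE _ _ Dx) (gLE _ _ Dx).
exact: (derive_comm oD (vlift v) (vlift w) sL Dx).
Qed.

End Lagrangian.

Lemma gLDl (L : TV -> R) x v v' w :
  gL L x (v + v') w = gL L x v w + gL L x v' w.
Proof. by rewrite /gL !mulmxDl mxE. Qed.

Lemma gLZl (L : TV -> R) x (k : R) v w : gL L x (k *: v) w = k * gL L x v w.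
Proof. by rewrite /gL -!scalemxAl mxE. Qed.

Lemma gLZr (L : TV -> R) x (k : R) v w : gL L x v (k *: w) = k * gL L x v w.
Proof. by rewrite /gL linearZ /= -scalemxAr mxE. Qed.

Lemma gLBl (L : TV -> R) x v v' w :
  gL L x (v - v') w = gL L x v w - gL L x v' w.
Proof. by rewrite /gL !mulmxBl !mxE. Qed.

Lemma gL0l (L : TV -> R) x w : gL L x 0 w = 0.
Proof. by rewrite /gL !mul0mx mxE. Qed.

Lemma gL_nondeg (L : TV -> R) x v : hess L x \in unitmx ->
  (forall w, gL L x v w = 0) -> v = 0.
Proof.
move=> uh gv; rewrite -[v](mulmxK uh).
suff -> : v *m hess L x = 0 by rewrite mul0mx.
apply/rowP => j; have := gv (delta_mx 0 j).
by rewrite /gL trmx_delta -colE !mxE.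
Qed.

Lemma gL_inj (L : TV -> R) x v v' : hess L x \in unitmx ->
  (forall w, gL L x v w = gL L x v' w) -> v = v'.
Proof.
move=> uh gv; apply/eqP; rewrite -subr_eq0; apply/eqP.
by apply: (gL_nondeg uh) => w; rewrite gLBl gv subrr.
Qed.

Section EulerLagrange.
Variables (L : TV -> R) (G : TV -> TV).
Hypothesis sL : smooth_on D (L : TV -> R^o).
Hypothesis sG : smooth_on D G.
Hypothesis regL : forall x, D x -> hess L x \in unitmx.
Hypothesis EL : forall x, D x -> forall eta,
  dform (dS L) x (G x) eta = - dfun (energy L) x eta.

Local Notation theta c := (fun y => theta_along L y c : R^o).

Let sth c : smooth_on D (theta c).
Proof. exact: smooth_theta. Qed.
Hint Resolve sth : core.

Lemma smooth_fiber : smooth_on D (fun y => vlift (rsubmx y)).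
Proof.
apply: (smooth_row_mx oD); first exact: smooth_cst.
by apply: (smooth_rsubmx oD); exact: smooth_id.
Qed.

Lemma derive_energy x eta : D x -> dfun (energy L) x eta =
  theta_along L x (rsubmx eta) + 'D_eta (theta (rsubmx x)) x - dfun L x eta.
Proof.
move=> Dx; have sF := smooth_fiber.
have DA : 'D_eta (fun y => vlift (rsubmx y)) x = vlift (rsubmx eta).
  rewrite derive_row_mx; last 2 first.
  - exact: derivable_cst.
  - exact: (smooth_derivable (smooth_rsubmx oD (smooth_id oD)) Dx).
  rewrite derive_cst (derive_rsubmx (A := fun y : TV => y));
    last exact: derivable_id.
  by rewrite derive_id.
have dL : derivable (L : TV -> R^o) x eta by exact: smooth_derivable Dx.
have sM := smooth_moving oD sL sF.
have := derive_moving oD eta sL sF Dx; rewrite DA => E.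
rewrite -E.
exact: (@deriveB _ _ _ _ _ _ _ (smooth_derivable sM Dx) dL).
Qed.

(** Tested on vertical vectors, the Euler-Lagrange equation only involves [g];
    by regularity the field is of second order. *)
Lemma EL_base x : D x -> lsubmx (G x) = rsubmx x.
Proof.
move=> Dx; apply: (gL_inj (regL Dx)) => w.
have := EL Dx (vlift w); rewrite dform_dSE derive_energy // lsub_vlift.
have -> : theta 0 = fun=> 0 by apply/funext => y; exact: theta0.
rewrite derive_cst /vlift row_mxKr -/(vlift w) addrAC subrr !add0r.
move=> /oppr_inj; rewrite -!gLE // => E.
by rewrite gLC // E gLC.
Qed.

(** Tested on base directions: by [EL_base] the derivatives of theta at frozen
    velocity cancel, which leaves the usual d/dt (dL/du) = dL/dq. *)
Lemma EL_fiber x c : D x -> 'D_(G x) (theta c) x = dfun L x (basedir c).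
Proof.
move=> Dx; have := EL Dx (basedir c); rewrite dform_dSE derive_energy //.
rewrite /basedir row_mxKl row_mxKr theta0 EL_base // add0r opprB.
by move=> /(canRL (subrK _)) ->; rewrite subrK.
Qed.

Lemma connE x a i : D x -> (a *m conn G x) 0 i =
  - 2^-1 * 'D_(vlift a) (fun y => rsubmx (G y) 0 i : R^o) x.
Proof.
move=> Dx; have sGi : smooth_on D (fun y => rsubmx (G y) 0 i : R^o).
  have /(smooth_rsubmx oD) /(smooth_mxP oD) := sG; exact.
rewrite (vlift_sum a) (derive_dir_sum oD) // mxE mulr_sumr.
apply: eq_bigr => j _.
by rewrite mxE mulrCA.
Qed.

(** The horizontal lift in terms of the vertical derivative of the
    Euler-Lagrange field: this is how differentiating [EL_fiber] along the
    fibre meets the connection. *)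
Lemma derive_spray x a : D x ->
  'D_(vlift a) G x = 2 *: hlift G x a - basedir a.
Proof.
move=> Dx; have dG := smooth_derivable (v := vlift a) sG Dx.
rewrite -['D_(vlift a) G x]hsubmxK -(derive_lsubmx dG) -(derive_rsubmx dG).
have -> : 'D_(vlift a) (fun y => lsubmx (G y)) x = a.
  rewrite (derive_eq_on oD _ EL_base Dx).
  rewrite (derive_rsubmx (A := fun y : TV => y)); last exact: derivable_id.
  by rewrite derive_id /vlift row_mxKr.
rewrite /hlift /basedir scale_row_mx opp_row_mx add_row_mx oppr0 addr0.
congr row_mx; first by rewrite scaler_nat mulr2n addrK.
have sr := smooth_rsubmx oD sG.
rewrite (derive_mx (smooth_derivable sr Dx)); apply/rowP => i; rewrite mxE.
rewrite 2!mxE connE // mulrN mulrA mulrN mulfV ?pnatr_eq0 // mulN1r opprK.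
by [].
Qed.

(** Differentiating [EL_fiber] along the fibre in direction [a] gives, by
    [derive_spray], a relation between derivatives of theta_c along [a^H] and
    of L along mixed directions, plus a term symmetric in [a] and [c].
    Antisymmetrising kills that term. *)
Lemma horizontal_lagrangian x a c : D x ->
  'D_(hlift G x a) (theta c) x = 'D_(hlift G x c) (theta a) x.
Proof.
move=> Dx.
have H a' c' : 2 * 'D_(hlift G x a') (theta c') x - 'D_(basedir a') (theta c') x
   + 'D_(G x) (fun y => 'D_(vlift a') (theta c') y : R^o) x
   = 'D_(basedir c') (theta a') x.
  rewrite -(derive_dirZ oD) // -(derive_dirB oD) // -derive_spray //.
  rewrite (derive_comm oD (G x) (vlift a') (sth c') Dx).
  rewrite -(derive_moving oD (vlift a') (sth c') sG Dx).
  rewrite (derive_comm oD (basedir c') (vlift a') sL Dx).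
  by apply: (derive_eq_on oD) Dx => y Dy; rewrite EL_fiber.
have T : 'D_(G x) (fun y => 'D_(vlift a) (theta c) y : R^o) x =
         'D_(G x) (fun y => 'D_(vlift c) (theta a) y : R^o) x.
  apply: (derive_eq_on oD) Dx => y Dy; exact: (derive_comm oD _ _ sL Dy).
have E := H a c; rewrite T in E.
exact: (antisym_cancel E (H c a)).
Qed.

End EulerLagrange.
End LagrangianGeometry.

(** * The recursion tensor in the adapted frame *)

Section RecursionOperator.
Context {R : realType} {n : nat}.
Local Notation TV := 'rV[R]_(n + n).
Variable D0 : set 'rV[R]_n.
Hypothesis oD0 : open D0.
Local Notation D := [set x : TV | D0 (lsubmx x)].
Implicit Types (x y xi eta : TV) (a b c d v w : 'rV[R]_n).

Let oD : open D := open_over oD0.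

Variables (L : TV -> R) (G : TV -> TV) (J : 'rV[R]_n -> 'M[R]_n).
Hypothesis sL : smooth_on D (L : TV -> R^o).
Hypothesis sG : smooth_on D G.
Hypothesis sJ : smooth_on D0 J.
Hypothesis regL : forall x, D x -> hess L x \in unitmx.
Hypothesis EL : forall x, D x -> forall eta,
  dform (dS L) x (G x) eta = - dfun (energy L) x eta.

Local Notation kappa c := (fun y => Jtheta J L y c : R^o).

Let movingJ c : smooth_on D (fun y => vlift (c *m J (lsubmx y))).
Proof.
apply: (smooth_row_mx oD); first exact: smooth_cst.
apply: (smooth_mulmx oD); first exact: smooth_cst.
exact: smooth_over.
Qed.

Lemma smooth_kappa c : smooth_on D (kappa c).
Proof. exact: (smooth_moving oD sL (movingJ c)). Qed.

(** [J] depends on the base point only, so it is constant along the fibre. *)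
Lemma derive_kappa_vertical x v c : D x ->
  'D_(vlift v) (kappa c) x = gL L x v (c *m J (lsubmx x)).
Proof.
move=> Dx; have := derive_moving oD (vlift v) sL (movingJ c) Dx.
rewrite (derive_over (fun q => vlift (c *m J q))) lsub_vlift derive0 derive0.
by rewrite add0r (gLE oD0 sL _ _ Dx).
Qed.

Lemma derive_adapted F x a b : smooth_on D (F : TV -> R^o) -> D x ->
  'D_(hlift G x a + vlift b) (F : TV -> R^o) x =
  'D_(hlift G x a) (F : TV -> R^o) x + 'D_(vlift b) (F : TV -> R^o) x.
Proof. by move=> sF Dx; exact: (derive_dirD oD). Qed.

Lemma lsub_adapted x a b : lsubmx (hlift G x a + vlift b) = a.
Proof. by rewrite /hlift /vlift add_row_mx row_mxKl addr0. Qed.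

Lemma dform_dS_adapted x a b c d : D x ->
  dform (dS L) x (hlift G x a + vlift b) (hlift G x c + vlift d) =
  gL L x b c - gL L x d a.
Proof.
move=> Dx; rewrite dform_dSE !lsub_adapted.
rewrite (derive_adapted a b (smooth_theta sL c) Dx).
rewrite (derive_adapted c d (smooth_theta sL a) Dx).
rewrite (horizontal_lagrangian oD0 sL sG regL EL a c Dx).
rewrite (gLE oD0 sL b c Dx) (gLE oD0 sL d a Dx).
move: ('D_(hlift G x c) _ x) => h.
by rewrite opprD addrACA subrr add0r.
Qed.

Lemma smooth_conn a : smooth_on D (fun y => a *m conn G y).
Proof.
apply/(smooth_mxP oD) => k i; rewrite (ord1 k).
have /(smooth_rsubmx oD) /(smooth_mxP oD) sGi := sG.
apply: (smooth_on_eq oD (f := fun y => (- 2^-1) *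
   'D_(vlift a) (fun z => rsubmx (G z) 0 i : R^o) y : R^o)).
  by move=> y Dy; rewrite (connE oD0 sG).
apply: (smoothM oD); first exact: smooth_cst.
exact: (smooth_derive _ (sGi 0 i)).
Qed.

Lemma DH_cst x a c : D x ->
  DH G (fun=> a) (fun=> c) x = 'D_(vlift c) (fun y => a *m conn G y) x.
Proof.
move=> Dx; have dc := smooth_derivable (v := vlift c) (smooth_conn a) Dx.
have E : 'D_(vlift c) (hlift_field G (fun=> a)) x =
         row_mx 0 (- 'D_(vlift c) (fun y => a *m conn G y) x).
  rewrite /hlift_field /hlift derive_row_mx; last 2 first.
  - exact: derivable_cst.
  - exact: derivableN.
  by rewrite derive_cst (deriveN dc).
rewrite /DH /lie_bracket {2}/vlift_field E /vlift_field derive_cst sub0r.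
by rewrite /vpart opp_row_mx opprK row_mxKl row_mxKr oppr0 mul0mx addr0.
Qed.

(** Both sides are -1/2 times a second vertical derivative of the force. *)
Lemma DH_cst_sym x a c : D x ->
  DH G (fun=> a) (fun=> c) x = DH G (fun=> c) (fun=> a) x.
Proof.
move=> Dx; rewrite !DH_cst //.
rewrite (derive_mx (smooth_derivable (smooth_conn a) Dx)).
rewrite (derive_mx (smooth_derivable (smooth_conn c) Dx)).
apply/rowP => i; rewrite !mxE.
have /(smooth_rsubmx oD) /(smooth_mxP oD) /(_ 0 i) sGi := sG.
have H a' c' : 'D_(vlift c') (fun y => (a' *m conn G y) 0 i : R^o) x =
   - 2^-1 * 'D_(vlift c') (fun y =>
       'D_(vlift a') (fun z => rsubmx (G z) 0 i : R^o) y : R^o) x.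
  have dd := smooth_derivable (v := vlift c') (smooth_derive (vlift a') sGi) Dx.
  apply: etrans _ (deriveZ (- 2^-1) dd); apply: (derive_eq_on oD) Dx => y Dy.
  exact: (connE oD0 sG _ _ Dy).
have := H c a; have := H a c; rewrite (derive_comm oD _ _ sGi Dx) => <- E.
by rewrite E.
Qed.

Lemma dH_Jtheta_cst x a c : D x ->
  dH G (Jtheta J L) (fun=> a) (fun=> c) x =
  'D_(hlift G x a) (kappa c) x - 'D_(hlift G x c) (kappa a) x.
Proof.
move=> Dx; rewrite /dH /DH_form (DH_cst_sym _ _ Dx).
by rewrite opprB addrA subrK.
Qed.

Variables (Jc Rt : TV -> 'M[R]_(n + n)) (Jbar U : TV -> 'M[R]_n).
Hypothesis JcV : forall x, D x -> forall v,
  vlift v *m Jc x = vlift (v *m J (lsubmx x)).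
Hypothesis JbarP : forall x, D x -> forall v w,
  gL L x (v *m J (lsubmx x)) w = gL L x v (w *m Jbar x).
Hypothesis UP : forall x, D x -> forall a c,
  gL L x (a *m U x) c = dH G (Jtheta J L) (fun=> a) (fun=> c) x.
Hypothesis RtP : forall x, D x -> forall xi eta,
  dform (dS L) x (xi *m Rt x) eta = dform (dJcS Jc L) x xi eta.

Lemma U_skew x a : D x -> gL L x (a *m U x) a = 0.
Proof. by move=> Dx; rewrite UP // dH_Jtheta_cst // subrr. Qed.

(** Composed with the vertical endomorphism, the complete lift only sees the
    vertical lifts of [J]. *)
Lemma dform_dJcSE x xi eta : D x -> dform (dJcS Jc L) x xi eta =
  'D_xi (kappa (lsubmx eta)) x - 'D_eta (kappa (lsubmx xi)) x.
Proof.
have E y zeta : D y -> dJcS Jc L y zeta = Jtheta J L y (lsubmx zeta).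
  by move=> Dy; rewrite /dJcS /dK mulmxA mul_vertical_endo JcV.
move=> Dx; rewrite /dform.
rewrite (derive_eq_on oD xi (fun y Dy => E y eta Dy) Dx).
by rewrite (derive_eq_on oD eta (fun y Dy => E y xi Dy) Dx).
Qed.

Lemma dform_dJcS_adapted x a b c d : D x ->
  dform (dJcS Jc L) x (hlift G x a + vlift b) (hlift G x c + vlift d) =
  gL L x (a *m U x) c + gL L x b (c *m J (lsubmx x))
  - gL L x d (a *m J (lsubmx x)).
Proof.
move=> Dx; rewrite dform_dJcSE // !lsub_adapted.
rewrite (derive_adapted a b (smooth_kappa c) Dx).
rewrite (derive_adapted c d (smooth_kappa a) Dx).
rewrite !derive_kappa_vertical // UP // dH_Jtheta_cst // opprD addrACA.
by rewrite addrA.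
Qed.

(** Both sides of the definition of R are now explicit in the adapted frame;
    pairing with vertical and with horizontal vectors separates the two
    components. *)
Lemma Rt_adapted x a b : D x ->
  (hlift G x a + vlift b) *m Rt x =
  hlift G x (a *m J (lsubmx x)) + vlift (a *m U x + b *m Jbar x).
Proof.
move=> Dx; set xi := _ + vlift b.
have H c d := RtP Dx xi (hlift G x c + vlift d).
rewrite (hpart_vpartE G x (xi *m Rt x)) in H *.
set a' := hpart _ in H *; set b' := vpart _ _ _ in H *.
have {}H c d : gL L x b' c - gL L x d a' =
   gL L x (a *m U x) c + gL L x b (c *m J (lsubmx x))
   - gL L x d (a *m J (lsubmx x)).
  by rewrite -dform_dS_adapted // H dform_dJcS_adapted.
have gC v w := gLC oD0 sL v w Dx.
congr (hlift G x _ + vlift _); apply: (gL_inj (regL Dx)) => w.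
- have := H 0 w; rewrite mul0mx gC gL0l [gL L x (_ *m U x) 0]gC gL0l.
  by rewrite [gL L x b 0]gC gL0l addr0 !sub0r => /oppr_inj; rewrite gC => ->.
- have := H w 0; rewrite !gL0l !subr0 => ->.
  by rewrite gLDl [gL L x b _]gC JbarP // [gL L x w _]gC.
Qed.

End RecursionOperator.

(** * Eigenbases and the singular equation *)

Section LinearAlgebra.
Context {R : realType} {n : nat}.

Lemma eigenvectors_unit (A : 'M[R]_n) (l : 'I_n -> R) (Z : 'I_n -> 'rV[R]_n) :
  injective l -> (forall i, is_eigenvector A (l i) (Z i)) ->
  \matrix_i Z i \in unitmx.
Proof.
move=> l_inj eZ; rewrite -row_free_unit; apply: inj_row_free => w wZ.
apply/rowP => i; rewrite mxE.
have [Zi0 _] := eZ i.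
have Zsub j (k : R) : (k *: Z j <= eigenspace A (l j))%MS.
  by apply: scalemx_sub; apply/eigenspaceP; have [_ ->] := eZ j.
have dS : mxdirect (\sum_(j | predT j) eigenspace A (l j))%MS.
  by apply: mxdirect_sum_eigenspace => j k _ _; exact: l_inj.
have /mxdirect_sumsP /(_ i isT) dSi := dS.
have : (w 0 i *: Z i <= (0 : 'M[R]_n))%MS.
  rewrite -dSi sub_capmx Zsub /=.
  have -> : w 0 i *: Z i = - (\sum_(j | j != i) w 0 j *: Z j).
    apply/eqP; rewrite -addr_eq0; apply/eqP; rewrite -[RHS]wZ mulmx_sum_row.
    rewrite [RHS](bigD1 i) //= rowK; congr (_ + _).
    by apply: eq_bigr => j _; rewrite rowK.
  rewrite -scaleN1r; apply: scalemx_sub; apply: summx_sub => j ji.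
  by apply: (submx_trans (Zsub j _)); apply: (sumsmx_sup j).
by rewrite submx0 scaler_eq0 (negbTE Zi0) orbF => /eqP.
Qed.

Lemma eigenvectors_mul (A : 'M[R]_n) (l : 'I_n -> R) (Z : 'I_n -> 'rV[R]_n) :
  (forall i, is_eigenvector A (l i) (Z i)) ->
  (\matrix_i Z i) *m A = diag_mx (\row_i l i) *m \matrix_i Z i.
Proof.
move=> eZ; apply/row_matrixP => i; rewrite row_mul rowK.
by have [_ ->] := eZ i; apply/rowP => k; rewrite mul_diag_mx !mxE.
Qed.

(** The second family has the shape [X_i^H + Y_i^V], [C] being the matrix of the
    connection at the point. *)
Lemma row_free_antitriangular (Z X Y : 'I_n -> 'rV[R]_n) (C : 'M[R]_n) :
  \matrix_i Z i \in unitmx -> \matrix_i X i \in unitmx ->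
  row_free (col_mx (\matrix_(i < n) vlift (Z i))
     (\matrix_(i < n) (row_mx (X i) (- (X i *m C)) + vlift (Y i)))).
Proof.
move=> uZ uX; apply: inj_row_free => v; rewrite -[v]hsubmxK mul_row_col.
set p := lsubmx v; set q := rsubmx v.
have -> : \matrix_(i < n) vlift (Z i) = row_mx 0 (\matrix_i Z i).
  apply/row_matrixP => i; rewrite rowK row_row_mx rowK row0; by [].
have -> : \matrix_(i < n) (row_mx (X i) (- (X i *m C)) + vlift (Y i)) =
   row_mx (\matrix_i X i) (- (\matrix_i X i *m C) + \matrix_i Y i).
  apply/row_matrixP => i.
  rewrite rowK row_row_mx linearD linearN /= row_mul !rowK.
  by rewrite /vlift add_row_mx addr0.
rewrite !mul_mx_row mulmx0 add_row_mx add0r => /eqP.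
rewrite row_mx_eq0 => /andP[/eqP q0].
have -> : q = 0 by rewrite -[q](mulmxK uX) q0 mul0mx.
rewrite mul0mx addr0 => /eqP p0.
have -> : p = 0 by rewrite -[p](mulmxK uZ) p0 mul0mx.
exact: row_mx0.
Qed.

End LinearAlgebra.

Section SingularEquation.
Context {R : realType} {n : nat}.
Implicit Types (W A : 'M[R]_n) (l : 'I_n -> R) (i j : 'I_n) (c : 'rV[R]_n).

(** The solution of (l_i - A) y = c without component on the i-th row of [W],
    where the rows of [W] are eigenvectors of [A]. *)
Definition eigen_solution W l i c : 'rV[R]_n :=
  (\row_j (if j == i then 0 else (c *m invmx W) 0 j / (l i - l j))) *m W.

Lemma eigen_solutionP W A l i c : W \in unitmx -> injective l ->
  W *m A = diag_mx (\row_j l j) *m W -> (c *m invmx W) 0 i = 0 ->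
  eigen_solution W l i c *m A = l i *: eigen_solution W l i c - c.
Proof.
move=> uW l_inj WA ci; rewrite /eigen_solution -mulmxA WA mulmxA.
rewrite -[X in _ = _ - X](mulmxKV uW) scalemxAl -mulmxBl; congr (_ *m _).
move: (c *m invmx W) ci => e ei.
apply/rowP => j; rewrite mul_mx_diag !mxE; case: eqVneq => [->|ji].
  by rewrite mul0r mulr0 ei subr0.
have lij : l i - l j != 0 by rewrite subr_eq0 (inj_eq l_inj) eq_sym.
by field.
Qed.

Lemma smooth_eigen_solution {V : normedModType R} (D : set V)
    (W : V -> 'M[R]_n) (l : V -> 'I_n -> R) i (c : V -> 'rV[R]_n) : open D ->
  smooth_on D W -> (forall x, D x -> W x \in unitmx) ->
  (forall j, smooth_on D (fun x => l x j : R^o)) ->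
  (forall x, D x -> injective (l x)) -> smooth_on D c ->
  smooth_on D (fun x => eigen_solution (W x) (l x) i (c x)).
Proof.
move=> oD sW uW sl l_inj sc; apply: (smooth_mulmx oD _ sW).
apply/(smooth_mxP oD) => k j; rewrite (ord1 k).
have [->|ji] := eqVneq j i.
  by apply: smooth_on_eq (smooth_cst oD (0 : R^o)) => // x _; rewrite mxE eqxx.
have /(smooth_mxP oD) scW := smooth_mulmx oD sc (smooth_invmx oD uW sW).
have dl x : D x -> l x i + - l x j != 0 :> R^o.
  by move=> Dx; rewrite subr_eq0 (inj_eq (l_inj x Dx)) eq_sym.
have sd := smoothV oD dl (smoothD oD (sl i) (smoothN oD (sl j))).
apply: smooth_on_eq (smoothM oD (scW 0 j) sd) => // x _.
by rewrite [RHS]mxE (negbTE ji).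
Qed.

Lemma gL_mul_row (L : 'rV[R]_(n + n) -> R) x c W w :
  gL L x (c *m W) w = \sum_j c 0 j * gL L x (row j W) w.
Proof.
rewrite mulmx_sum_row; elim/big_rec2: _ => [|j s v _ IH]; first exact: gL0l.
by rewrite gLDl gLZl IH.
Qed.

(** The eigenvectors other than the i-th are g-orthogonal to [w] and the i-th is
    not, so g(-, w) detects the i-th coordinate in the eigenbasis. *)
Lemma solvability (L : 'rV[R]_(n + n) -> R) x W i c w : W \in unitmx ->
  (exists v, gL L x v w != 0) ->
  (forall j, j != i -> gL L x (row j W) w = 0) ->
  gL L x c w = 0 -> (c *m invmx W) 0 i = 0.
Proof.
move=> uW [v gv] gW.
have E u : gL L x u w = (u *m invmx W) 0 i * gL L x (row i W) w.
  rewrite -{1}[u](mulmxKV uW) gL_mul_row (bigD1 i) //= big1 ?addr0 // => j ji.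
  by rewrite gW // mulr0.
rewrite E => /eqP; rewrite mulf_eq0 => /orP[/eqP //|/eqP gi].
by move: gv; rewrite E gi mulr0 eqxx.
Qed.

End SingularEquation.

(** * Global statement *)

Section Charts.
Context {R : realType} {n : nat} {Q : topologicalType}.
Variable M : smooth_structure R n Q.
Implicit Types a b : chart M.

Lemma ToverlapP a b (x : 'rV[R]_(n + n)) : Toverlap a b x ->
  [/\ Tdom a x, Tdom b (Ttrans a b x) &
      param b (lsubmx (Ttrans a b x)) = param a (lsubmx x)].
Proof.
move=> [p [pa pb] px].
have E : lsubmx (Ttrans a b x) = Defs.coord b p.
  by rewrite /Ttrans row_mxKl /trans /= -px coordK.
rewrite E -px !coordK //; split=> //.
  by rewrite /Tdom /= -px; exists p.
by rewrite /Tdom /= E; exists p.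
Qed.

End Charts.

Unset Implicit Arguments.

Theorem proposition9 (R : realType) (n : nat) (Q : topologicalType)
    (M : smooth_structure R n Q)
    (L : chart M -> 'rV[R]_(n + n) -> R)
    (J : chart M -> 'rV[R]_n -> 'M[R]_n)
    (lam : 'I_n -> Q -> R)
    (G : chart M -> 'rV[R]_(n + n) -> 'rV[R]_(n + n))
    (Jc Rt : chart M -> 'rV[R]_(n + n) -> 'M[R]_(n + n))
    (Jbar U : chart M -> 'rV[R]_(n + n) -> 'M[R]_n)
    (X Z : 'I_n -> chart M -> 'rV[R]_(n + n) -> 'rV[R]_n) :
  function_on_TQ L -> regular L ->
  tensor11_on_base J -> diagonalizable_with J lam ->
  (forall p i j, i != j -> lam i p != lam j p) ->
  (forall p i, lam i p != 0) ->
  euler_lagrange_field L G ->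
  complete_lift J Jc ->
  R_tensor L Jc Rt ->
  g_transpose L J Jbar ->
  U_tensor L G J U ->
  (forall i, eigenvector_along (fun a x => J a (lsubmx x)) (lam i) (X i)) ->
  (forall i, eigenvector_along Jbar (lam i) (Z i)) ->
  let Yspec (i : 'I_n) (Yi : chart M -> 'rV[R]_(n + n) -> 'rV[R]_n) :=
    vfield_along Yi /\
    forall a x, Tdom a x ->
      Yi a x *m Jbar a x =
      lam i (param a (lsubmx x)) *: Yi a x - X i a x *m U a x in
  (forall i, exists Yi, Yspec i Yi) /\
  (forall Y : 'I_n -> chart M -> 'rV[R]_(n + n) -> 'rV[R]_n,
    (forall i, Yspec i (Y i)) ->
    forall a x, Tdom a x ->
      (forall i, is_eigenvector (Rt a x) (lam i (param a (lsubmx x)))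
                   (vlift (Z i a x))) /\
      (forall i, is_eigenvector (Rt a x) (lam i (param a (lsubmx x)))
                   (hlift (G a) x (X i a x) + vlift (Y i a x))) /\
      row_free (col_mx
        (\matrix_(i < n) vlift (Z i a x))
        (\matrix_(i < n) (hlift (G a) x (X i a x) + vlift (Y i a x))))).
Proof.
move=> [sL _] regL [sJ _] _ lam_neq _ [[sG _] EL] [_ JcP] [_ RtP].
move=> [[sJbar _] JbarP] [[sU trU] UP] eX eZ.
have oC (a : chart M) : open (cdom a) by exact: coord_dom_open.
have oT (a : chart M) : open (Tdom a) := open_over (oC a).
pose l (a : chart M) (x : 'rV[R]_(n + n)) j := lam j (param a (lsubmx x)).
have l_inj (a : chart M) (x : 'rV[R]_(n + n)) : injective (l a x).
  move=> i j lij; apply/eqP/negPn/negP => /(lam_neq (param a (lsubmx x))).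
  by rewrite -/(l a x i) lij eqxx.
have JcV (a : chart M) (x : 'rV[R]_(n + n)) : Tdom a x -> forall v,
    vlift v *m Jc a x = vlift (v *m J a (lsubmx x)).
  by move=> Dx v; have [_ ->] := JcP a (fun=> v) (smooth_cst (oC a) v) x Dx.
have UPc (a : chart M) (x : 'rV[R]_(n + n)) : Tdom a x -> forall v w,
    gL (L a) x (v *m U a x) w =
    dH (G a) (Jtheta (J a) (L a)) (fun=> v) (fun=> w) x.
  by move=> Dx v w; apply: UP => //; exact: smooth_cst.
have uX (a : chart M) (x : 'rV[R]_(n + n)) : Tdom a x ->
    \matrix_i X i a x \in unitmx.
  by move=> Dx; apply: eigenvectors_unit (l_inj a x) _ => i; exact: (eX i).2.
have uZ (a : chart M) (x : 'rV[R]_(n + n)) : Tdom a x ->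
    \matrix_i Z i a x \in unitmx.
  by move=> Dx; apply: eigenvectors_unit (l_inj a x) _ => i; exact: (eZ i).2.
have ZJ (a : chart M) (x : 'rV[R]_(n + n)) : Tdom a x ->
    \matrix_i Z i a x *m Jbar a x =
    diag_mx (\row_i l a x i) *m \matrix_i Z i a x.
  by move=> Dx; apply: eigenvectors_mul => i; exact: (eZ i).2.
have RtE (a : chart M) (x : 'rV[R]_(n + n)) v w (Dx : Tdom a x) :
    (hlift (G a) x v + vlift w) *m Rt a x =
    hlift (G a) x (v *m J a (lsubmx x)) + vlift (v *m U a x + w *m Jbar a x).
  exact: (Rt_adapted (oC a) (sL a) (sG a) (sJ a) (regL a) (EL a)
            (JcV a) (JbarP a) (UPc a) (RtP a) v w Dx).
split=> [i|Y YP a x Dx]; last first.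
  split; [|split] => [i|i|].
  - have [Zi0 ZiJ] := (eZ i).2 a x Dx; split.
      by apply: contraNneq Zi0; rewrite -(row_mx0 R 1 n n) => /eq_row_mx[_ ->].
    have := RtE a x 0 (Z i a x) Dx; rewrite !mul0mx ZiJ /hlift !mul0mx oppr0.
    rewrite row_mx0 !add0r => ->.
    by rewrite -[_ *: _ in LHS]addr0 vlift_lincomb vlift0 addr0.
  - have [Xi0 XiJ] := (eX i).2 a x Dx; split.
      apply: contraNneq Xi0; rewrite /hlift /vlift add_row_mx addr0.
      by rewrite -(row_mx0 R 1 n n) => /eq_row_mx[-> _].
    rewrite RtE // XiJ (YP i).2 // [_ + (_ - _)]addrC subrK.
    rewrite /hlift /vlift !add_row_mx scale_row_mx !addr0 -scalemxAl.
    by rewrite scalerDr scalerN.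
  - exact: row_free_antitriangular (uZ a x Dx) (uX a x Dx).
pose W (a : chart M) (x : 'rV[R]_(n + n)) := \matrix_j Z j a x.
pose Yi (a : chart M) (x : 'rV[R]_(n + n)) :=
  eigen_solution (W a x) (l a x) i (X i a x *m U a x).
have sW (a : chart M) : smooth_on (Tdom a) (W a).
  apply/(smooth_mxP (oT a)) => j k.
  have [[sZ _] _] := eZ j; have /(smooth_mxP (oT a)) /(_ 0 k) := sZ a.
  by apply: (smooth_on_eq (oT a)) => x _; rewrite mxE.
(* The eigenvalues are the diagonal entries of Z Jbar Z^-1. *)
have sl (a : chart M) j : smooth_on (Tdom a) (fun x => l a x j : R^o).
  have := smooth_mulmx (oT a) (smooth_mulmx (oT a) (sW a) (sJbar a))
            (smooth_invmx (oT a) (uZ a) (sW a)).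
  move=> /(smooth_mxP (oT a)) /(_ j j); apply: (smooth_on_eq (oT a)) => x Dx.
  by rewrite ZJ // mulmxK ?uZ // !mxE eqxx.
exists Yi; split; first split=> [a|a b x ov].
- apply: (smooth_eigen_solution i (oT a) (sW a) (uZ a) (sl a)
            (fun x _ => l_inj a x)).
  by apply: (smooth_mulmx (oT a)) (sU a); exact: (eX i).1.1.
- have [Da Db pE] := ToverlapP ov; set x' := Ttrans a b x in Db pE *.
  set jac := jacobian _ _.
  have lE : l b x' = l a x by apply/funext => j; rewrite /l pE.
  have WE : W b x' = W a x *m jac.
    apply/row_matrixP => j; rewrite row_mul !rowK.
    by have [[_ ->]] := eZ j.
  have cE : X i b x' *m U b x' *m invmx (W b x') =
            X i a x *m U a x *m invmx (W a x).
    have [[_ trX] _] := eX i.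
    rewrite (trX a b x ov) -/jac -[X i a x *m jac *m _]mulmxA.
    rewrite -(trU a b x ov) -/jac mulmxA.
    rewrite -[X i a x *m U a x in LHS](mulmxKV (uZ a x Da)).
    by rewrite -/(W a x) -(mulmxA _ (W a x) jac) -WE mulmxK //; exact: uZ.
  by rewrite /Yi /eigen_solution cE lE WE mulmxA.
- move=> a x Dx; apply: eigen_solutionP; [exact: uZ|exact: l_inj|exact: ZJ|].
  have [Xi0 XiJ] := (eX i).2 a x Dx.
  apply: (solvability (L := L a) (x := x) (w := X i a x)); first exact: uZ.
  + apply/not_existsP => g0; move/eqP: Xi0; apply.
    apply: (gL_nondeg (regL a x Dx)) => w.
    rewrite (gLC (oC a) (sL a)) //.
    by apply/eqP/negPn/negP; exact: g0.
  + move=> j ji; rewrite rowK (gLC (oC a) (sL a)) //.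
    have [_ ZjJ] := (eZ j).2 a x Dx.
    have := JbarP a x Dx (X i a x) (Z j a x); rewrite XiJ ZjJ gLZl gLZr => /eqP.
    rewrite -subr_eq0 -mulrBl mulf_eq0 subr_eq0 => /orP[lij|/eqP //].
    have := lam_neq (param a (lsubmx x)) i j.
    by rewrite eq_sym ji lij => /(_ isT).
  + exact: (U_skew (oC a) (sG a) (UPc a)).
Qed.
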